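(* Let $K$ be an algebraically closed field of characteristic not equal to $2$ and $3$. Let $A$ be an alternative algebra over $K$, $E$ a vector space that contains $A$ as a subspace, and $V$ a linear complement of $A$ in $E$. Let $\mathfrak{T}(A,V)$ be the set of all extending structures of $A$ by $V$. (1) Put $\mathcal{H}^2_A(V,A):=\mathfrak{T}(A,V)/\equiv$. Then the map $$\mathcal{H}^2_A(V,A)\to \mathrm{Extd}(E,A),\qquad \overline{\Omega(A,V)}\mapsto (A\natural V,\bullet),$$ is bijective, where $\overline{\Omega(A,V)}$ is the equivalence class of $\Omega(A,V)$ under $\equiv$. (2) Put $\mathcal{H}^2(V,A):=\mathfrak{T}(A,V)/\approx$. Then the map $$\mathcal{H}^2(V,A)\to \mathrm{Extd}'(E,A),\qquad \overline{\overline{\Omega(A,V)}}\mapsto (A\natural V,\bullet),$$ is bijective, where $\overline{\overline{\Omega(A,V)}}$ is the equivalence class of $\Omega(A,V)$ under $\approx$. (On the right-hand sides, $(A\natural V,\bullet)$ stands for the class of the corresponding algebra structure on $E=A\oplus V$.)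
   Context: An alternative algebra is a vector space $A$ with a bilinear multiplication $\circ$ such that, with $(x,y,z)=(x\circ y)\circ z-x\circ(y\circ z)$, one has $(x,y,z)=-(y,x,z)$ and $(x,y,z)=-(x,z,y)$ for all $x,y,z$. An extending datum of $A$ by $V$ is a system $\Omega(A,V)=(\triangleright,\triangleleft,\rightharpoonup,\leftharpoonup,*,\omega)$ of bilinear maps $\triangleright:A\times V\to V$, $\triangleleft:V\times A\to V$, $\rightharpoonup:V\times A\to A$, $\leftharpoonup:A\times V\to A$, $*:V\times V\to V$, $\omega:V\times V\to A$. $A\natural V$ denotes $A\oplus V$ with multiplication $$(x,u)\bullet(y,v)=\big(x\circ y+u\rightharpoonup y+x\leftharpoonup v+\omega(u,v),\ u*v+x\triangleright v+u\triangleleft y\big).$$ $\Omega(A,V)$ is an extending structure if this makes $A\oplus V$ an alternative algebra. The space $A\oplus V$ is identified with $E$ by $(x,u)\mapsto x+u$, so that $\bullet$ becomes an alternative algebra structure on $E$ containing $A$ as a subalgebra. Structures on $E$: let $\circ,\circ'$ be two alternative algebra structures on $E$ both containing $A$ as an alternative subalgebra, and let $\pi:E=A\oplus V\to V$ be the projection along $A$. They are called equivalent if there is an alternative algebra isomorphism $\varphi:(E,\circ)\to(E,\circ')$ with $\varphi|_A=\mathrm{id}_A$ ($\varphi$ stabilizes $A$), and cohomologous if moreover $\varphi$ can be chosen with $\pi\circ\varphi=\pi$ ($\varphi$ co-stabilizes $V$). These are equivalence relations; $\mathrm{Extd}(E,A)$ (resp. $\mathrm{Extd}'(E,A)$) is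 the set of equivalence classes of such structures under equivalence (resp. being cohomologous). Relations on $\mathfrak{T}(A,V)$: let $\Omega(A,V)=(\triangleright,\triangleleft,\rightharpoonup,\leftharpoonup,*,\omega)$ and $\Omega'(A,V)=(\triangleright',\triangleleft',\rightharpoonup',\leftharpoonup',*',\omega')$ be extending structures. $\Omega(A,V)\equiv\Omega'(A,V)$ means that there exist a linear map $r:V\to A$ and a linear isomorphism $s:V\to V$ such that for all $x\in A$, $u,v\in V$: $s(u\triangleleft x)=s(u)\triangleleft' x$; $s(x\triangleright u)=x\triangleright' s(u)$; $s(u*v)=r(u)\triangleright' s(v)+s(u)\triangleleft' r(v)+s(u)*'s(v)$; $r(u\triangleleft x)=r(u)\circ x-u\rightharpoonup x+s(u)\rightharpoonup' x$; $r(x\triangleright u)=x\circ r(u)-x\leftharpoonup u+x\leftharpoonup' s(u)$; $r(u*v)=r(u)\circ r(v)+\omega'(s(u),s(v))-\omega(u,v)+r(u)\leftharpoonup' s(v)+s(u)\rightharpoonup' r(v)$. $\Omega(A,V)\approx\Omega'(A,V)$ means that these conditions hold for some linear $r:V\to A$ with $s=\mathrm{id}_V$, i.e. $\triangleleft=\triangleleft'$, $\triangleright=\triangleright'$, $u\rightharpoonup x=r(u)\circ x+u\rightharpoonup' x-r(u\triangleleft' x)$, $x\leftharpoonup u=x\circ r(u)+x\leftharpoonup' u-r(x\triangleright' u)$, $u*v=r(u)\triangleright' v+u\triangleleft' r(v)+u*'v$, and $\omega(u,v)=r(u)\circ r(v)+r(u)\leftharpoonup' v+u\rightharpoonup' r(v)+\omega'(u,v)-r\big(r(u)\triangleright'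 v+u\triangleleft' r(v)+u*'v\big)$. *)

(* Defs.v *)
From HB Require Import structures.
From mathcomp Require Import all_boot all_algebra.
From mathcomp Require Import boolp classical_sets functions.

Set Implicit Arguments.
Unset Strict Implicit.
Unset Printing Implicit Defensive.

Import GRing.Theory.
Local Open Scope classical_set_scope.
Local Open Scope ring_scope.

Section Quotient.
Context {X Y : Type}.

(* This is the equivalence class of [x] when [R] is an equivalence relation. *)
Definition eqclass (R : X -> X -> Prop) (x : X) : set X := [set y | R x y].

Definition quotient (R : X -> X -> Prop) : set (set X) := range (eqclass R).

End Quotient.

(* The existence of [F] includes the fact that [class of x |-> class of f x]
   does not depend on the representative; [F] is determined on [quotient R]. *)
Definition induces_bijection (X Y : Type) (R : X -> X -> Prop)
    (S : Y -> Y -> Prop) (f : X -> Y) : Prop :=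
  exists F : set X -> set Y,
    (forall x, F (eqclass R x) = eqclass S (f x)) /\
    set_bij (quotient R) (quotient S) F.

Section Alternative.
Context {K : fieldType}.

Definition associator (U : lmodType K) (m : U -> U -> U) (x y z : U) : U :=
  m (m x y) z - m x (m y z).

Definition alternative (U : lmodType K) (m : U -> U -> U) : Prop :=
  (forall x y z, associator m x y z = - associator m y x z) /\
  (forall x y z, associator m x y z = - associator m x z y).

Record alt_alg (U : lmodType K) := AltAlg {
  alt_mul :> {bilinear U -> U -> U};
  alt_mulP : alternative alt_mul
}.

Definition alt_iso (U : lmodType K) (m m' : alt_alg U) (f : {linear U -> U}) :
    Prop :=
  bijective f /\ forall x y, f (m x y) = m' (f x) (f y).

Lemma alt_iso_inv (U : lmodType K) (m m' : alt_alg U) (f : {linear U -> U}) :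
  alt_iso m m' f -> exists2 g : {linear U -> U}, alt_iso m' m g & cancel f g.
Proof.
move=> [[g fg gf] fM].
have gl : linear g.
  by move=> a x y; rewrite -{1}[x]gf -{1}[y]gf -linearP fg.
pose gL : {linear U -> U} :=
  HB.pack g (GRing.isLinear.Build K U U *:%R g gl).
exists gL => //; split; first by exists f.
by move=> x y /=; rewrite -{1}[x]gf -{1}[y]gf -fM fg.
Qed.

Record ext_datum (A V : lmodType K) := ExtDatum {
  ltri : {bilinear A -> V -> V};  (* x |> u *)
  rtri : {bilinear V -> A -> V};  (* u <| x *)
  lharp : {bilinear V -> A -> A}; (* u -^ x, harpoon to the right *)
  rharp : {bilinear A -> V -> A}; (* x ^- u, harpoon to the left *)
  vmul : {bilinear V -> V -> V};
  cocy : {bilinear V -> V -> A}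
}.

Definition bullet (A V : lmodType K) (mA : alt_alg A) (O : ext_datum A V)
    (p q : A * V) : A * V :=
  (mA p.1 q.1 + lharp O p.2 q.1 + rharp O p.1 q.2 + cocy O p.2 q.2,
   vmul O p.2 q.2 + ltri O p.1 q.2 + rtri O p.2 q.1).

Lemma bullet_bilinear (A V : lmodType K) (mA : alt_alg A) (O : ext_datum A V) :
  bilinear_for *:%R *:%R (bullet mA O).
Proof.
split=> [q|p] a p1 p2; rewrite /bullet; congr pair;
  rewrite /= ?linearPl ?linearPr /= !scalerDr.
- by rewrite (addrACA (a *: _)) (addrACA (a *: _ + a *: _))
             (addrACA (a *: _ + a *: _ + a *: _)).
- by rewrite (addrACA (a *: _)) (addrACA (a *: _ + a *: _)).
- by rewrite (addrACA (a *: _)) (addrACA (a *: _ + a *: _))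
             (addrACA (a *: _ + a *: _ + a *: _)).
- by rewrite (addrACA (a *: _)) (addrACA (a *: _ + a *: _)).
Qed.

Record ext_struct (A V : lmodType K) (mA : alt_alg A) := ExtStruct {
  ext_of :> ext_datum A V;
  ext_alt : alternative (bullet mA ext_of)
}.

Section Relations.
Context (A V : lmodType K) (mA : alt_alg A).

Definition compatible (O O' : ext_datum A V) (r : V -> A) (s : V -> V) : Prop :=
  (forall u x, s (rtri O u x) = rtri O' (s u) x) /\
  (forall x u, s (ltri O x u) = ltri O' x (s u)) /\
  (forall u v, s (vmul O u v) =
     ltri O' (r u) (s v) + rtri O' (s u) (r v) + vmul O' (s u) (s v)) /\
  (forall u x, r (rtri O u x) = mA (r u) x - lharp O u x + lharp O' (s u) x) /\
  (forall x u, r (ltri O x u) = mA x (r u) - rharp O x u + rharp O' x (s u)) /\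
  (forall u v, r (vmul O u v) =
     mA (r u) (r v) + cocy O' (s u) (s v) - cocy O u v
     + rharp O' (r u) (s v) + lharp O' (s u) (r v)).

Definition ext_equiv (O O' : ext_struct V mA) : Prop :=
  exists (r : {linear V -> A}) (s : {linear V -> V}),
    bijective s /\ compatible O O' r s.

Definition ext_approx (O O' : ext_struct V mA) : Prop :=
  exists r : {linear V -> A}, compatible O O' r id.

End Relations.

Section Subspaces.
Context {E : lmodType K} {PA PV : pred E}.

Definition complementary : Prop :=
  (forall e, exists x u, [/\ x \in PA, u \in PV & e = x + u]) /\
  (forall e, e \in PA -> e \in PV -> e = 0).

Context {A : subLmodType PA} {V : subLmodType PV} (hAV : complementary).

Lemma compA_ex (e : E) : exists x : A, e - \val x \in PV.
Proof.
have [x [u [Ax Vu ->]]] := hAV.1 e.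
by exists (Sub x Ax); rewrite SubK addrC addKr.
Qed.

Lemma compV_ex (e : E) : exists u : V, e - \val u \in PA.
Proof.
have [x [u [Ax Vu ->]]] := hAV.1 e.
by exists (Sub u Vu); rewrite SubK addrK.
Qed.

Definition projA (e : E) : A := xchoose (compA_ex e).
Definition projV (e : E) : V := xchoose (compV_ex e).

Lemma decomp_uniq (x y : A) (u v : V) :
  \val x + \val u = \val y + \val v -> x = y /\ u = v.
Proof.
move=> exy.
have d : \val (x - y) = \val (v - u) :> E.
  rewrite !raddfB /=; apply/eqP.
  by rewrite subr_eq addrAC -addrA addrCA addrA eq_sym subr_eq eq_sym exy addrC.
have z : \val (x - y) = 0 :> E.
  by apply: hAV.2; [exact: valP | rewrite d; exact: valP].
split; first by apply/eqP; rewrite -subr_eq0 -(inj_eq val_inj) z raddf0.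
by apply/eqP; rewrite eq_sym -subr_eq0 -(inj_eq val_inj) -d z raddf0.
Qed.

Lemma projD (e : E) : e = \val (projA e) + \val (projV e).
Proof.
set x := projA e; have hx : e - \val x \in PV := xchooseP (compA_ex e).
set u := projV e; have hu : e - \val u \in PA := xchooseP (compV_ex e).
have e1 : \val x + \val (Sub (e - \val x) hx : V) = e :> E.
  by rewrite SubK addrC subrK.
have e2 : \val (Sub (e - \val u) hu : A) + \val u = e :> E.
  by rewrite SubK subrK.
have [_ <-] := decomp_uniq (etrans e1 (esym e2)).
by rewrite e1.
Qed.

Lemma projK (x : A) (u : V) :
  projA (\val x + \val u) = x /\ projV (\val x + \val u) = u.
Proof. by apply: decomp_uniq; rewrite -projD. Qed.

Definition join (p : A * V) : E := \val p.1 + \val p.2.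
Definition split_sum (e : E) : A * V := (projA e, projV e).

Lemma split_sumK : cancel split_sum join.
Proof. by move=> e; rewrite /join -projD. Qed.

Lemma joinK : cancel join split_sum.
Proof. by case=> x u; rewrite /split_sum /join; have [-> ->] := projK x u. Qed.

Lemma join_linear : linear join.
Proof. by move=> a p q; rewrite /join /= !linearP /= scalerDr addrACA. Qed.

Lemma split_sum_linear : linear split_sum.
Proof.
by move=> a e f; apply: (can_inj joinK); rewrite join_linear !split_sumK.
Qed.

Record ext_alg (mA : alt_alg A) := ExtAlg {
  alg_of :> alt_alg E;
  alg_sub : forall x y : A, alg_of (\val x) (\val y) = \val (mA x y)
}.

Definition alg_equiv (mA : alt_alg A) (m m' : ext_alg mA) : Prop :=
  exists f : {linear E -> E},
    alt_iso m m' f /\ (forall x : A, f (\val x) = \val x).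

Definition alg_cohom (mA : alt_alg A) (m m' : ext_alg mA) : Prop :=
  exists f : {linear E -> E},
    [/\ alt_iso m m' f, forall x : A, f (\val x) = \val x
      & forall e, projV (f e) = projV e].

Lemma alg_equiv_equivalence (mA : alt_alg A) :
  RelationClasses.Equivalence (@alg_equiv mA).
Proof.
split=> [m|m m' [f [fi fA]]|m m' m'' [f [[fb fM] fA]] [g [[gb gM] gA]]].
- by exists idfun; split=> //; split=> //; exists id.
- have [g gi fg] := alt_iso_inv fi.
  by exists g; split=> // x; rewrite -[in LHS](fA x) fg.
- exists (g \o f); split=> [|x /=]; last by rewrite fA gA.
  by split=> [|x y /=]; [exact: bij_comp | rewrite fM gM].
Qed.

Lemma alg_cohom_equivalence (mA : alt_alg A) :
  RelationClasses.Equivalence (@alg_cohom mA).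
Proof.
split=> [m|m m' [f [fi fA fp]]|m m' m'' [f [[fb fM] fA fp]] [g [[gb gM] gA gp]]].
- by exists idfun; split=> //; split=> //; exists id.
- have [g gi fg] := alt_iso_inv fi.
  exists g; split=> // [x|e]; first by rewrite -[in LHS](fA x) fg.
  by have [h _ hf] := fi.1; rewrite -[e]hf fg fp.
- exists (g \o f); split=> [|x /=|e /=]; rewrite ?fA ?gA ?gp ?fp //.
  by split=> [|x y /=]; [exact: bij_comp | rewrite fM gM].
Qed.

Section Natural.
Context {mA : alt_alg A}.

(* [bullet] carried to [E] along [(x, u) |-> x + u] *)
Definition natural_mul (O : ext_datum A V) (e f : E) : E :=
  join (bullet mA O (split_sum e) (split_sum f)).

Lemma natural_bilinear (O : ext_datum A V) :
  bilinear_for *:%R *:%R (natural_mul O).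
Proof.
have [bl br] := bullet_bilinear mA O.
by split=> [f|e] a e1 e2; rewrite /natural_mul split_sum_linear;
  [rewrite bl | rewrite br]; rewrite join_linear.
Qed.

HB.instance Definition _ (O : ext_datum A V) :=
  bilinear_isBilinear.Build K E E E *:%R *:%R (natural_mul O)
    (natural_bilinear O).

Lemma natural_associator (O : ext_datum A V) (e f g : E) :
  associator (natural_mul O) e f g =
  join (associator (bullet mA O) (split_sum e) (split_sum f) (split_sum g)).
Proof.
rewrite /associator /natural_mul !joinK.
by rewrite addrC -scaleN1r -join_linear scaleN1r addrC.
Qed.

Lemma natural_alternative (O : ext_struct V mA) :
  alternative (natural_mul O).
Proof.
have jN p : join (- p) = - join p.
  by rewrite /join /= !raddfN /= -opprD.
have [al ar] := ext_alt O.
split=> e f g; rewrite !natural_associator -jN.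
  by rewrite al.
by rewrite ar.
Qed.

Lemma split_val (x : A) : split_sum (\val x) = (x, 0).
Proof. by rewrite -(joinK (x, 0)) /join /= raddf0 addr0. Qed.

Lemma natural_sub (O : ext_struct V mA) (x y : A) :
  natural_mul O (\val x) (\val y) = \val (mA x y).
Proof.
rewrite /natural_mul !split_val /bullet /join /=.
by rewrite !(linear0l, linear0r) !addr0 raddf0 addr0.
Qed.

Definition natural (O : ext_struct V mA) : ext_alg mA :=
  @ExtAlg mA (AltAlg (natural_alternative O)) (natural_sub O).

End Natural.

End Subspaces.

End Alternative.

Arguments ext_equiv {K A V mA} O O'.
Arguments ext_approx {K A V mA} O O'.
Arguments complementary {K E} PA PV.
Arguments alg_equiv {K E PA A mA} m m'.
Arguments alg_cohom {K E PA PV A V} hAV {mA} m m'.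
Arguments natural {K E PA PV A V} hAV {mA} O.

(* Main.v *)
Require Import Defs.
From HB Require Import structures.
From mathcomp Require Import all_boot all_algebra.
From mathcomp Require Import boolp classical_sets functions.
Import GRing.Theory.
Local Open Scope ring_scope.

(** Everything takes place on pairs.  Through [join], [E] is [A * V], and a
    linear map [E -> E] that fixes [A] pointwise is a block triangular map
    [(x, u) |-> (x + r u, s u)], here called a shear; it is bijective exactly
    when [s] is, and it preserves the [V]-component exactly when [s] is the
    identity.  So an isomorphism of algebras that stabilizes [A] is a pair
    [(r, s)] whose shear is multiplicative for the two products [bullet].

    The products are bilinear, so the multiplicativity of a shear need only be
    tested on the four products of a vector of [A] or [V] by a vector of [A] or
    [V] ([bilinear_ext]).  The product of two vectors of [A] gives no
    condition, since a shear fixes [A]; the [A]- and [V]-components of the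
    three others are the six equations of [compatible] ([shear_morphP]).
    Hence [ext_equiv] and [ext_approx] are the inverse images of [alg_equiv]
    and [alg_cohom] under [natural].

    Conversely, let [m] be an alternative product on [E] that extends that of
    [A].  The components of the products of vectors of [A] and [V] under [m]
    form an extending datum ([datum_of]); its [bullet] agrees with [m] on the
    four kinds of products, hence everywhere, and so is alternative.  Thus
    [natural] is onto, up to equality of products.

    Both bijections, as well as the fact that the relations on extending
    structures are equivalences, then follow from [induces_bijection_of_iff]:
    a map that is surjective up to an equivalence, and along which a relation
    is the inverse image of this equivalence, is bijective on classes. *)

(** * Maps induced on classes *)

Section Classes.
Context {X Y : Type} (R : X -> X -> Prop) (S : Y -> Y -> Prop) (f : X -> Y).

Lemma equivalence_of_iff :
  RelationClasses.Equivalence S -> (forall x x', R x x' <-> S (f x) (f x')) ->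
  RelationClasses.Equivalence R.
Proof.
move=> [Srefl Ssym Strans] RS; split=> [x|x y|x y z]; rewrite !RS //.
- exact: Ssym.
- exact: Strans.
Qed.

Lemma induces_bijection_of_iff :
  RelationClasses.Equivalence S -> (forall x x', R x x' <-> S (f x) (f x')) ->
  (forall y, exists x, S (f x) y) -> induces_bijection R S f.
Proof.
move=> SE RS fsurj; have [Srefl Ssym Strans] := SE.
have [Rrefl _ _] := equivalence_of_iff SE RS.
(* The saturation of the image of a class avoids choosing representatives. *)
pose F (C : set X) : set Y := [set y | exists2 x, C x & S (f x) y]%classic.
have FE x : F (eqclass R x) = eqclass S (f x).
  apply/seteqP; split=> [y [x' /RS xx' x'y]|y xy]; first exact: Strans xx' x'y.
  by exists x => //; apply: Rrefl.
exists F; split=> //; split.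
- by move=> _ [x _ <-]; rewrite /= FE; exists (f x).
- move=> _ _ /set_mem[x _ <-] /set_mem[x' _ <-]; rewrite !FE => eq_xx'.
  have xx' : S (f x) (f x').
    by have : eqclass S (f x') (f x') := Srefl _; rewrite -eq_xx'.
  by apply/seteqP; split=> z /RS xz; apply/RS; [exact: Strans (Ssym _ _ xx') xz
    | exact: Strans xx' xz].
- move=> _ [y _ <-]; have [x xy] := fsurj y.
  exists (eqclass R x); first by exists x.
  rewrite FE; apply/seteqP; split=> z yz; [exact: Strans (Ssym _ _ xy) yz
    | exact: Strans xy yz].
Qed.

End Classes.

(** * Bilinear maps on a direct sum *)

Section Bilinear.
Context {K : fieldType}.

Section Pullback.
Context {U1 U2 W1 W2 W X : lmodType K} (h : {linear W -> X})
  (b : {bilinear W1 -> W2 -> W})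
  (f : {linear U1 -> W1}) (g : {linear U2 -> W2}).

(** Both sides of the multiplicativity equations, and the operations of a datum
    extracted from a product on [E], are bilinear maps of this form. *)
Definition bilinear_comp (x : U1) (y : U2) : X := h (b (f x) (g y)).

Lemma bilinear_comp_bilinear : bilinear_for *:%R *:%R bilinear_comp.
Proof.
split=> [y|x] a u v; rewrite /bilinear_comp.
  by rewrite linearP linearPl linearP.
by rewrite linearP linearPr linearP.
Qed.

HB.instance Definition _ := bilinear_isBilinear.Build K U1 U2 X *:%R *:%R
  bilinear_comp bilinear_comp_bilinear.

End Pullback.

Lemma bilinear_ext {A V W : lmodType K}
    (b b' : {bilinear (A * V)%type -> (A * V)%type -> W}) :
    (forall x y, b (x, 0) (y, 0) = b' (x, 0) (y, 0)) ->
    (forall x v, b (x, 0) (0, v) = b' (x, 0) (0, v)) ->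
    (forall u y, b (0, u) (y, 0) = b' (0, u) (y, 0)) ->
    (forall u v, b (0, u) (0, v) = b' (0, u) (0, v)) ->
  forall p q, b p q = b' p q.
Proof.
move=> bAA bAV bVA bVV [x u] [y v].
have dec (z : A) (w : V) : (z, w) = (z, 0) + (0, w).
  by apply/esym; congr pair; rewrite /= ?addr0 ?add0r.
by rewrite (dec x) (dec y) !linearDl !linearDr bAA bAV bVA bVV.
Qed.

End Bilinear.

(** * Shears and compatible pairs *)

Section Shear.
Context {K : fieldType} {A V : lmodType K}.

Section Def.
Context (r : {linear V -> A}) (s : {linear V -> V}).

Definition shear (p : A * V) : A * V := (p.1 + r p.2, s p.2).

Lemma shear_linear : linear shear.
Proof.
move=> a p q; rewrite /shear /= !linearP; congr pair.
by rewrite /= scalerDr addrACA.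
Qed.

HB.instance Definition _ :=
  GRing.isLinear.Build K (A * V)%type (A * V)%type *:%R shear shear_linear.

Lemma shear_bij : bijective shear <-> bijective s.
Proof.
split=> -[g gK Kg].
  exists (fun v => (g (0, v)).2) => [u|v].
    (* The vector that the shear sends to (0, s u) is (- r u, u). *)
    have -> : (0, s u) = shear (- r u, u) by rewrite /shear /= addNr.
    by rewrite gK.
  by have /(congr1 snd) := Kg (0, v).
exists (fun p => (p.1 - r (g p.2), g p.2)) => -[x u]; rewrite /shear /=.
  by rewrite gK addrK.
by rewrite Kg subrK.
Qed.

End Def.

Context {mA : alt_alg A}.

HB.instance Definition _ (O : ext_datum A V) :=
  bilinear_isBilinear.Build K (A * V)%type (A * V)%type (A * V)%type *:%R *:%R
    (bullet mA O) (bullet_bilinear mA O).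

Lemma bulletAA (O : ext_datum A V) x y :
  bullet mA O (x, 0) (y, 0) = (mA x y, 0).
Proof. by rewrite /bullet /= !(linear0l, linear0r, addr0). Qed.

Lemma bulletAV (O : ext_datum A V) x v :
  bullet mA O (x, 0) (0, v) = (rharp O x v, ltri O x v).
Proof. by rewrite /bullet /= !(linear0l, linear0r, addr0, add0r). Qed.

Lemma bulletVA (O : ext_datum A V) u y :
  bullet mA O (0, u) (y, 0) = (lharp O u y, rtri O u y).
Proof. by rewrite /bullet /= !(linear0l, linear0r, addr0, add0r). Qed.

Lemma bulletVV (O : ext_datum A V) u v :
  bullet mA O (0, u) (0, v) = (cocy O u v, vmul O u v).
Proof. by rewrite /bullet /= !(linear0l, linear0r, addr0, add0r). Qed.

Lemma addr_eq_subr {W : zmodType} (a b c d : W) :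
  a + b = c + d <-> b = c - a + d.
Proof.
split=> [abcd|->]; first by rewrite addrAC -abcd addrC addKr.
by rewrite addrA (addrC a) subrK.
Qed.

(** The six equations of [compatible] are, rearranged, the components of the
    multiplicativity of the shear on the products [A V], [V A] and [V V]. *)
Lemma shear_morphP (O O' : ext_datum A V) r s :
  (forall p q, shear r s (bullet mA O p q) =
               bullet mA O' (shear r s p) (shear r s q)) <->
  compatible mA O O' r s.
Proof.
have shA x : shear r s (x, 0) = (x, 0) by rewrite /shear /= !raddf0 addr0.
have shV u : shear r s (0, u) = (r u, s u) by rewrite /shear /= add0r.
have AV x v : bullet mA O' (x, 0) (r v, s v) =
    (mA x (r v) + rharp O' x (s v), ltri O' x (s v)).
  by rewrite /bullet /= !(linear0l, linear0r, addr0, add0r).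
have VA u y : bullet mA O' (r u, s u) (y, 0) =
    (mA (r u) y + lharp O' (s u) y, rtri O' (s u) y).
  by rewrite /bullet /= !(linear0l, linear0r, addr0, add0r).
have VV u v : bullet mA O' (r u, s u) (r v, s v) =
    (mA (r u) (r v) + (cocy O' (s u) (s v) + rharp O' (r u) (s v)
       + lharp O' (s u) (r v)),
     ltri O' (r u) (s v) + rtri O' (s u) (r v) + vmul O' (s u) (s v)).
  rewrite /bullet /=; congr pair; last by rewrite [RHS]addrC addrA.
  by rewrite -!addrA; congr (_ + _); rewrite addrC addrCA addrA addrAC.
split=> [sM|[c1 [c2 [c3 [c4 [c5 c6]]]]]].
  have sAV x v := sM (x, 0) (0, v); have sVA u y := sM (0, u) (y, 0).
  have sVV u v := sM (0, u) (0, v).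
  apply: (conj _ (conj _ (conj _ (conj _ (conj _ _)))))
    => [u x|x u|u v|u x|x u|u v].
  - by move: (sVA u x); rewrite bulletVA shA shV VA => -[].
  - by move: (sAV x u); rewrite bulletAV shA shV AV => -[].
  - by move: (sVV u v); rewrite bulletVV !shV VV => -[].
  - by move: (sVA u x); rewrite bulletVA shA shV VA => -[/addr_eq_subr].
  - by move: (sAV x u); rewrite bulletAV shA shV AV => -[/addr_eq_subr].
  - move: (sVV u v); rewrite bulletVV !shV VV => -[/addr_eq_subr -> _].
    by rewrite !addrA (addrAC (mA _ _)).
apply: (bilinear_ext
  (bilinear_comp (shear r s) (bullet mA O) idfun idfun)
  (bilinear_comp idfun (bullet mA O') (shear r s) (shear r s)));
  rewrite /= /bilinear_comp /=.
- by move=> x y; rewrite !shA !bulletAA shA.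
- move=> x v; rewrite shA shV bulletAV AV -c2; congr pair.
  exact/addr_eq_subr/c5.
- move=> u y; rewrite shA shV bulletVA VA -c1; congr pair.
  exact/addr_eq_subr/c4.
- move=> u v; rewrite !shV bulletVV VV -c3; congr pair.
  by apply/addr_eq_subr; rewrite c6 !addrA (addrAC (mA _ _)).
Qed.

End Shear.

(** * Comparing structures on the ambient space *)

Section Ambient.
Context {K : fieldType} {E : lmodType K} {PA PV : pred E}.
Context {A : subLmodType PA} {V : subLmodType PV} (hAV : complementary PA PV).

HB.instance Definition _ := GRing.isLinear.Build K (A * V)%type E *:%R
  (@join K E PA PV A V) join_linear.

HB.instance Definition _ := GRing.isLinear.Build K E (A * V)%type *:%R
  (@split_sum K E PA PV A V hAV) (split_sum_linear hAV).

Lemma projA_linear : linear (projA hAV : E -> A).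
Proof.
move=> a e f.
by have /(congr1 fst) := split_sum_linear (A := A) (V := V) hAV a e f.
Qed.

Lemma projV_linear : linear (projV hAV : E -> V).
Proof.
move=> a e f.
by have /(congr1 snd) := split_sum_linear (A := A) (V := V) hAV a e f.
Qed.

HB.instance Definition _ :=
  GRing.isLinear.Build K E A *:%R (projA hAV : E -> A) projA_linear.

HB.instance Definition _ :=
  GRing.isLinear.Build K E V *:%R (projV hAV : E -> V) projV_linear.

Lemma projV_join (p : A * V) : projV hAV (join p) = p.2.
Proof. by case: p => x u; have [] := projK hAV x u. Qed.

Lemma join_inl (x : A) : join (x, 0 : V) = \val x.
Proof. by rewrite /join /= raddf0 addr0. Qed.

Lemma join_inr (u : V) : join (0 : A, u) = \val u.
Proof. by rewrite /join /= raddf0 add0r. Qed.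

Definition ambient_shear (r : {linear V -> A}) (s : {linear V -> V}) :
    {linear E -> E} :=
  (@join K E PA PV A V \o shear r s \o split_sum hAV)%FUN.

Lemma ambient_shear_val r s (x : A) : ambient_shear r s (\val x) = \val x.
Proof.
by rewrite /ambient_shear /= split_val /shear /= !raddf0 addr0 join_inl.
Qed.

Lemma ambient_shear_bij r s : bijective (ambient_shear r s) <-> bijective s.
Proof.
have bj : bijective (@join K E PA PV A V).
  by exists (split_sum hAV); [exact: joinK | exact: split_sumK].
have bs : bijective (@split_sum K E PA PV A V hAV).
  by exists join; [exact: split_sumK | exact: joinK].
rewrite -(shear_bij r); split=> [bF|bsh]; last first.
  by apply: bij_comp => //; apply: bij_comp.
apply: (@eq_bij _ _ (split_sum hAV \o ambient_shear r s \o join)).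
  by apply: bij_comp => //; apply: bij_comp.
by move=> p; rewrite /ambient_shear /= !joinK.
Qed.

(** Such an [f] sends [x + u] to [x + f u], so it is the shear given by the two
    components of its restriction to [V]. *)
Lemma linear_fix_shear {f : {linear E -> E}} :
  (forall x : A, f (\val x) = \val x) ->
  forall e, f e = ambient_shear (projA hAV \o f \o \val)%FUN
                                (projV hAV \o f \o \val)%FUN e.
Proof.
move=> fA e; rewrite [in LHS](projD (A := A) (V := V) hAV e) raddfD /= fA.
rewrite /ambient_shear /= /join /shear /= raddfD -addrA; congr (_ + _).
exact: projD.
Qed.

Context {mA : alt_alg A}.
Implicit Types O : ext_struct V mA.

(** Conjugating by [join] turns the product of [natural] into [bullet] and this
    map into a shear, so that the criterion on pairs applies. *)
Lemma ambient_shear_isoP O O' r s :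
  alt_iso (natural hAV O) (natural hAV O') (ambient_shear r s) <->
  bijective s /\ compatible mA O O' r s.
Proof.
rewrite /alt_iso ambient_shear_bij -shear_morphP.
(split=> -[sb sM]; split=> //) => [p q|e e'].
  apply: (can_inj (joinK hAV)); move: (sM (join p) (join q)).
  by rewrite /= /natural_mul /ambient_shear /= !joinK.
by rewrite /= /natural_mul /ambient_shear /= !joinK sM.
Qed.

Lemma alt_iso_eq {U : lmodType K} {m m' : alt_alg U} {f g : {linear U -> U}} :
  f =1 g -> alt_iso m m' f -> alt_iso m m' g.
Proof.
move=> fg [fb fM]; split; first exact: eq_bij fb _ fg.
by move=> x y; rewrite -!fg.
Qed.

Lemma ext_equivP O O' :
  ext_equiv O O' <-> alg_equiv (natural hAV O) (natural hAV O').
Proof.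
split=> [[r [s /ambient_shear_isoP iso]]|[f [fi fA]]].
  by exists (ambient_shear r s); split=> // x; apply: ambient_shear_val.
exists (projA hAV \o f \o \val)%FUN, (projV hAV \o f \o \val)%FUN.
apply/ambient_shear_isoP.
exact: alt_iso_eq (linear_fix_shear fA) fi.
Qed.

Lemma ext_approxP O O' :
  ext_approx O O' <-> alg_cohom (V := V) hAV (natural hAV O) (natural hAV O').
Proof.
split=> [[r comp_r]|[f [fi fA fV]]].
  exists (ambient_shear r idfun); split=> [|x|e].
  - by apply/ambient_shear_isoP; split=> //; exists id.
  - exact: ambient_shear_val.
  - by rewrite /ambient_shear /= projV_join.
(* As [f] preserves the [V]-component, the [V]-part of its shear is the
   identity. *)
set r : {linear V -> A} := (projA hAV \o f \o \val)%FUN.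
exists r; suff /ambient_shear_isoP[] : alt_iso (natural hAV O) (natural hAV O')
  (ambient_shear r idfun) by [].
apply: alt_iso_eq fi => e; rewrite (linear_fix_shear fA) /ambient_shear /=.
by rewrite /shear /= fV -join_inr projV_join.
Qed.

(** * Every structure comes from an extending structure *)

Section Datum.
Context (m : ext_alg mA).

(** The only possible datum: each operation is read off as a component of [m]
    on vectors of [A] and [V]. *)
Definition datum_of : ext_datum A V :=
  let vA : {linear A -> E} := \val in let vV : {linear V -> E} := \val in
  let pA : {linear E -> A} := projA hAV in
  let pV : {linear E -> V} := projV hAV in
  ExtDatum (bilinear_comp pV m vA vV) (bilinear_comp pV m vV vA)
    (bilinear_comp pA m vV vA) (bilinear_comp pA m vA vV)
    (bilinear_comp pV m vV vV) (bilinear_comp pA m vV vV).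

(** On two vectors of [A] this is the hypothesis that [m] extends [mA]; on the
    other pairs it holds because a vector is the sum of its components. *)
Lemma join_bullet_datum_of p q :
  join (bullet mA datum_of p q) = m (join p) (join q).
Proof.
move: p q; apply: (bilinear_ext
  (bilinear_comp (@join K E PA PV A V) (bullet mA datum_of) idfun idfun)
  (bilinear_comp idfun m (@join K E PA PV A V) (@join K E PA PV A V)));
  rewrite /= /bilinear_comp /=.
- by move=> x y; rewrite bulletAA !join_inl alg_sub.
- by move=> x v; rewrite bulletAV join_inl join_inr /join -projD.
- by move=> u y; rewrite bulletVA join_inl join_inr /join -projD.
- by move=> u v; rewrite bulletVV !join_inr /join -projD.
Qed.

Lemma datum_of_alternative : alternative (bullet mA datum_of).
Proof.
have jassoc p q t : join (associator (bullet mA datum_of) p q t) =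
    associator m (join p) (join q) (join t).
  by rewrite /associator raddfB /= !join_bullet_datum_of.
have [al ar] := alt_mulP m.
by split=> p q t; apply: (can_inj (joinK hAV)); rewrite raddfN /= !jassoc;
  [exact: al | exact: ar].
Qed.

Lemma natural_surj :
  exists O, forall e e' : E, natural hAV O e e' = m e e'.
Proof.
exists (ExtStruct datum_of_alternative) => e e'.
by rewrite /= /natural_mul join_bullet_datum_of !split_sumK.
Qed.

End Datum.

Lemma natural_surj_cohom (m : ext_alg mA) :
  exists O, alg_cohom (V := V) hAV (natural hAV O) m.
Proof.
by have [O OE] := natural_surj m; exists O, idfun; split=> //; split.
Qed.

Lemma natural_surj_equiv (m : ext_alg mA) :
  exists O, alg_equiv (natural hAV O) m.
Proof. by have [O [f [fi fA _]]] := natural_surj_cohom m; exists O, f. Qed.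

End Ambient.

(** * The two classifications *)

Theorem theorem3p7 (K : closedFieldType)
  (hK2 : 2%N \notin [pchar K]) (hK3 : 3%N \notin [pchar K])
  (E : lmodType K) (PA PV : pred E)
  (A : subLmodType PA) (V : subLmodType PV)
  (hAV : complementary PA PV) (mA : alt_alg A) :
  (RelationClasses.Equivalence (@ext_equiv K A V mA) /\
   induces_bijection (@ext_equiv K A V mA) (@alg_equiv K E PA A mA)
     (natural hAV)) /\
  (RelationClasses.Equivalence (@ext_approx K A V mA) /\
   induces_bijection (@ext_approx K A V mA) (@alg_cohom K E PA PV A V hAV mA)
     (natural hAV)).
Proof.
have eqE := alg_equiv_equivalence mA.
have eqC := alg_cohom_equivalence (V := V) hAV mA.
split; split.
- exact: equivalence_of_iff eqE (ext_equivP hAV).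
- exact: induces_bijection_of_iff eqE (ext_equivP hAV) (natural_surj_equiv hAV).
- exact: equivalence_of_iff eqC (ext_approxP hAV).
- exact: induces_bijection_of_iff eqC (ext_approxP hAV) (natural_surj_cohom hAV).
Qed.
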